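(* Let $\omega\in\Omega^d_{\mathrm{can}}$ be a canonical form of degree $d$. Then $\mathrm{gr}_\ell I(\omega)=0$ for all loop orders $\ell<2+2\lceil d/4\rceil$; that is, $I_G(\omega)=0$ for every oriented graph $G$ in $\mathcal{GC}_3$ with loop number $\ell<2+2\lceil d/4\rceil$.
   Context: $\lceil x\rceil$ is the smallest integer $\ge x$. $\Omega_{\mathrm{can}}^\bullet$ is the graded exterior $\mathbb Q$-algebra on symbols $\beta^{4k+1}$ of degree $4k+1$, $k\ge1$. **Graph complex.** A graph $G$ consists of finite sets of vertices $V(G)$, edges $E(G)$ and half-edges; each edge $e$ consists of two half-edges $H(e)=\{e',e''\}$, each incident to a vertex (multiple edges, self-loops allowed). With $\det M=\bigwedge^{\mathrm{rk}M}M$, an orientation of a connected graph is a generator of $\det\mathbb Z^{V(G)}\otimes\bigotimes_e\det\mathbb Z^{H(e)}$, equivalently (by a canonical isomorphism) of $\det\mathbb Z^{E(G)}\otimes\det H_1(G)$. $\mathcal{GC}_3$ is the $\mathbb Q$-span of oriented connected graphs with all valencies $\ge3$, modulo $(G,o)\sim(G',\varphi_*o)$ for isomorphisms $\varphi:G\cong G'$ and $(G,-o)\sim-(G,o)$. The loop number is $\ell=|E(G)|-|V(G)|+1$. **Integrals.** Let $G$ have $m$ edges and orientation $o=e_1\wedge\dots\wedge e_m\otimes C_1\wedge\dots\wedge C_\ell$ with $\mathcal C=(C_1,\dots,C_\ell)$ a basis of $H_1(G)\subset\mathbb Z^m$ (an $m\times\ell$ matrix). Put $\Lambda_{\mathcal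 C}(x)=\mathcal C^T\mathrm{diag}(x_1,\dots,x_m)\mathcal C$ and $$I_{G}(\omega)=\frac1{(-2\pi)^{\ell/2}}\int_{\sigma_G}\phi_G\wedge\omega_G,$$ where $\sigma_G=\{[x_1:\dots:x_m]:x_i>0\}\subset\mathbb P(\mathbb R^m)$ is oriented by $\sum_i(-1)^{i-1}x_i\,dx_1\wedge\cdots\widehat{dx_i}\cdots\wedge dx_m$, and $\omega_G,\phi_G$ are the pullbacks along $\Lambda_{\mathcal C}$ of the forms on positive definite symmetric $\ell\times\ell$ matrices $X$ given by $\beta^{4k+1}=\mathrm{tr}((X^{-1}dX)^{4k+1})$ and $\phi^\ell=\mathrm{Pf}(dX\,X^{-1}dX)/\sqrt{\det X}$ (Pfaffian; $\phi^\ell=0$ for $\ell$ odd). By convention the integral is $0$ if $\ell+\deg\omega\ne m-1$. $I(\omega):\mathcal{GC}_3\to\mathbb R$ is the resulting linear function and $\mathrm{gr}_\ell I(\omega)$ is its restriction to the part of loop number $\ell$. *)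

(* Defs.v *)
From HB Require Import structures.
From mathcomp Require Import all_boot all_order all_fingroup all_algebra finmap.
From mathcomp Require Import all_classical all_reals all_analysis.

Set Implicit Arguments.
Unset Strict Implicit.
Unset Printing Implicit Defensive.

Import Order.TTheory GRing.Theory Num.Theory.
Import numFieldNormedType.Exports.

Local Open Scope ring_scope.

(* An element is given by its coefficients: a S is the coefficient of
   dx_(s_1) /\ ... /\ dx_(s_k) for S = {s_1 < ... < s_k}.                    *)
Definition ext (A : comNzRingType) (n : nat) : Type := {ffun {set 'I_n} -> A}.

Section Exterior.
Variables (A : comNzRingType) (n : nat).
Implicit Types (a b c : ext A n) (S T U V : {set 'I_n}).

HB.instance Definition _ :=
  GRing.Lmodule.copy (ext A n) {ffun {set 'I_n} -> A^o}.

(* the number of transpositions needed to sort dx_T /\ dx_U *)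
Definition ninv T U : nat := (\sum_(t in T) \sum_(u in U) (u < t))%N.

Definition wedge a b : ext A n :=
  [ffun S : {set 'I_n} => \sum_(T : {set 'I_n} | T \subset S)
     (-1) ^+ ninv T (S :\: T) * (a T * b (S :\: T))].

Definition ext1 : ext A n := [ffun S : {set 'I_n} => (S == finset.set0)%:R].

Definition dgen (i : 'I_n) : ext A n :=
  [ffun S : {set 'I_n} => (S == [set i])%:R].

Lemma sum_setU_disjoint T U (F : 'I_n -> nat) : [disjoint T & U] ->
  (\sum_(i in T :|: U) F i = \sum_(i in T) F i + \sum_(i in U) F i)%N.
Proof.
move=> TU; rewrite -bigU //; apply: eq_bigl => i; by rewrite !inE.
Qed.

Lemma ninvUl T U V : [disjoint T & U] ->
  ninv (T :|: U) V = (ninv T V + ninv U V)%N.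
Proof. exact: sum_setU_disjoint. Qed.

Lemma ninvUr T U V : [disjoint U & V] ->
  ninv T (U :|: V) = (ninv T U + ninv T V)%N.
Proof.
move=> UV; rewrite /ninv -big_split; apply: eq_bigr => t _ /=.
exact: sum_setU_disjoint.
Qed.

Lemma wedgeA : associative wedge.
Proof.
move=> a b c; apply/ffunP => S; rewrite !ffunE.
transitivity (\sum_(T : {set 'I_n} | T \subset S)
  \sum_(U : {set 'I_n} | U \subset S :\: T)
   (-1) ^+ ninv T (S :\: T) * (-1) ^+ ninv U (S :\: T :\: U) *
   (a T * (b U * c (S :\: T :\: U)))).
  apply: eq_bigr => T _; rewrite ffunE !mulr_sumr.
  by apply: eq_bigr => U _; rewrite -[RHS]mulrA; congr (_ * _); rewrite mulrCA.
transitivity (\sum_(W : {set 'I_n} | W \subset S)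
  \sum_(T : {set 'I_n} | T \subset W)
   (-1) ^+ ninv W (S :\: W) * (-1) ^+ ninv T (W :\: T) *
   (a T * (b (W :\: T) * c (S :\: W)))); last first.
  apply: eq_bigr => W _; rewrite ffunE mulr_suml mulr_sumr.
  by apply: eq_bigr => T _; rewrite !mulrA.
rewrite [RHS](exchange_big_dep (fun T => T \subset S)) /=; last first.
  by move=> W T WS /fintype.subset_trans; apply.
apply: eq_bigr => T TS.
rewrite [RHS](reindex_onto (fun U => T :|: U) (fun W => W :\: T)) /=; last first.
  move=> W /andP[_ TW]; apply/finset.setP => i; rewrite !inE.
  by case: (boolP (i \in T)) => //= /(fintype.subsetP TW) ->.
apply: eq_big => [U|U US].
  apply/idP/idP.
    rewrite finset.subsetD => /andP[US dUT].
    rewrite finset.subUset TS US finset.subsetUl /=.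
    by rewrite finset.setDUl finset.setDv finset.set0U; apply/eqP/finset.setDidPl.
  case/andP => /andP[]; rewrite finset.subUset => /andP[_ US] _ /eqP <-.
  by rewrite finset.setDUl finset.setDv finset.set0U finset.setSD.
move: US; rewrite finset.subsetD => /andP[US dUT].
have dTU : [disjoint T & U] by rewrite disjoint_sym.
have -> : (T :|: U) :\: T = U.
  by rewrite finset.setDUl finset.setDv finset.set0U; apply/finset.setDidPl.
have E : S :\: T :\: U = S :\: (T :|: U) by rewrite finset.setDDl.
set V := S :\: T :\: U; rewrite -E -/V.
have -> : S :\: T = U :|: V.
  apply/finset.setP => i; rewrite !inE; case: (boolP (i \in U)) => //= iU.
  rewrite (fintype.subsetP US _ iU) andbT.
  by rewrite (disjointFr dUT iU).
congr (_ * _); rewrite -!exprD ninvUl // ninvUr; last first.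
  by rewrite /V disjoint_sym finset.disjoints_subset finset.subsetDr.
by congr (_ ^+ _); rewrite -addnA addnC.
Qed.

Lemma wedge1l : left_id ext1 wedge.
Proof.
move=> a; apply/ffunP => S; rewrite ffunE (bigD1 finset.set0) ?finset.sub0set //=.
rewrite big1 => [|T /andP[_ /negPf T0]]; last first.
  by rewrite ffunE T0 mul0r mulr0.
by rewrite ffunE eqxx finset.setD0 /ninv finset.big_set0 expr0 !mul1r addr0.
Qed.

Lemma wedge1r : right_id ext1 wedge.
Proof.
move=> a; apply/ffunP => S; rewrite ffunE (bigD1 S) //=.
rewrite big1 => [|T /andP[TS TnS]]; last first.
  rewrite ffunE finset.setD_eq0; case: (boolP (S \subset T)) => ST.
    by move: TnS; rewrite finset.eqEsubset TS ST.
  by rewrite !mulr0.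
rewrite ffunE finset.setDv eqxx mulr1 /ninv big1 ?expr0 ?mul1r ?addr0 //.
by move=> t _; rewrite finset.big_set0.
Qed.

Lemma wedgeDl : left_distributive wedge +%R.
Proof.
move=> a b c; apply/ffunP => S; rewrite !ffunE -big_split.
by apply: eq_bigr => T _ /=; rewrite ffunE mulrDl mulrDr.
Qed.

Lemma wedgeDr : right_distributive wedge +%R.
Proof.
move=> a b c; apply/ffunP => S; rewrite !ffunE -big_split.
by apply: eq_bigr => T _ /=; rewrite ffunE !mulrDr.
Qed.

Lemma ext1_neq0 : ext1 != 0.
Proof.
by apply/eqP => /ffunP/(_ finset.set0)/eqP; rewrite !ffunE eqxx oner_eq0.
Qed.

HB.instance Definition _ := GRing.Zmodule_isNzRing.Build (ext A n)
  wedgeA wedge1l wedge1r wedgeDl wedgeDr ext1_neq0.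

Lemma wedgeZl (r : A) a b : r *: (a * b) = r *: a * b.
Proof.
apply/ffunP => S; rewrite !ffunE scaler_sumr; apply: eq_bigr => T _.
by rewrite ffunE /GRing.scale /= !mulrA [r * _]mulrC.
Qed.

HB.instance Definition _ := GRing.Lmodule_isLalgebra.Build A (ext A n) wedgeZl.

End Exterior.

Definition dform (R : realType) (n : nat) : Type := 'rV[R]_n -> ext R n.

Section Forms.
Variables (R : realType).

Definition dfun n (f : 'rV[R]_n -> R) : dform R n :=
  fun x => \sum_(i < n) 'D_(delta_mx 0 i) f x *: dgen R i.

(* Products over S : {set 'I_p} are taken in increasing order. *)
Definition pullback n p (F : 'rV[R]_n -> 'rV[R]_p) (eta : dform R p) :
    dform R n :=
  fun x => \sum_(S : {set 'I_p})
    eta (F x) S *: \prod_(t in S) dfun (fun y => F y 0 t) x.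

End Forms.

Section Lebesgue.
Variable R : realType.
Local Notation RR := (measurableTypeR R).
Local Open Scope classical_set_scope.

Definition tcons n (p : RR * n.-tuple RR) : n.+1.-tuple RR :=
  [the n.+1.-tuple RR of p.1 :: p.2].

Lemma measurable_tcons n : measurable_fun [set: RR * n.-tuple RR] (@tcons n).
Proof. exact: measurable_cons. Qed.

Definition tuncons n (t : n.+1.-tuple RR) : RR * n.-tuple RR :=
  (thead t, [tuple of behead t]).

Lemma tunconsK n : cancel (@tuncons n) (@tcons n).
Proof. by move=> t; rewrite [RHS]tuple_eta; apply: val_inj. Qed.

Lemma tconsK n : cancel (@tcons n) (@tuncons n).
Proof. by case=> x t; congr (_, _); apply: val_inj. Qed.

Lemma measurable_tuncons n : measurable_fun [set: n.+1.-tuple RR] (@tuncons n).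
Proof.
apply/measurable_fun_pairP; split; last exact: measurable_behead.
exact: (@measurable_tnth _ RR n.+1 ord0).
Qed.

Section Step.
Variables (n : nat) (mu : {sigma_finite_measure set (n.-tuple RR) -> \bar R}).

Definition lebesgue_cons : set (n.+1.-tuple RR) -> \bar R :=
  pushforward (lebesgue_measure \x mu)%E (@tcons n).

HB.instance Definition _ := Measure.copy lebesgue_cons
  [the {measure set _ -> \bar R} of
    measure_function_pushforward__canonical__measure_function_Measure
      (lebesgue_measure \x mu)%E (@measurable_tcons n)].

Let sigma_finite_lebesgue_cons : sigma_finite setT lebesgue_cons.
Proof.
have /sigma_finiteP[F [FT ndF Foo]] := sigma_finiteT (@lebesgue_measure R).
have /sigma_finiteP[G [GT ndG Goo]] := sigma_finiteT mu.
exists (fun i => @tuncons n @^-1` (F i `*` G i)).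
  apply/esym; rewrite -subTset => t _.
  have [i _ Fi] : (\bigcup_i F i) (tuncons t).1 by rewrite -FT.
  have [j _ Gj] : (\bigcup_i G i) (tuncons t).2 by rewrite -GT.
  exists (maxn i j) => //; split.
  - by apply: (subsetPset _ _ (ndF _ _ (leq_maxl i j))).
  - by apply: (subsetPset _ _ (ndG _ _ (leq_maxr i j))).
move=> i; have [mF Fi] := Foo i; have [mG Gi] := Goo i; split.
  rewrite -[X in measurable X]setTI.
  by apply: measurable_tuncons => //; exact: measurableX.
rewrite /lebesgue_cons /pushforward.
rewrite (_ : _ @^-1` _ = F i `*` G i); last first.
  by apply/funext => p; rewrite /preimage /mkset tconsK.
by rewrite product_measure1E // lte_mul_pinfty // ge0_fin_numE.
Qed.

HB.instance Definition _ := @Measure_isSigmaFinite.Build _ _ _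
  lebesgue_cons sigma_finite_lebesgue_cons.

End Step.

(* The n-fold product of Lebesgue measure on R; on R^0 = {[::]} it is the unit
   mass.                                                                     *)
Fixpoint lebesgue_tuple n : {sigma_finite_measure set (n.-tuple RR) -> \bar R} :=
  match n with
  | 0%N => [the {sigma_finite_measure set _ -> \bar R} of
              \d_([tuple] : 0.-tuple RR)]
  | n'.+1 => [the {sigma_finite_measure set _ -> \bar R} of
              lebesgue_cons (lebesgue_tuple n')]
  end.

End Lebesgue.

Section Simplex.
Variable R : realType.
Local Open Scope classical_set_scope.

Definition affine_chart n (y : 'rV[R]_n) : 'rV[R]_n.+1 :=
  row_mx (const_mx 1 : 'rV[R]_1) y.

Definition orthant n : set (n.-tuple (measurableTypeR R)) :=
  [set y | forall i, 0 < tnth y i].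

(* The integral of a projective form eta of degree m - 1, given on the cone
   x_i > 0, is computed in the chart x_1 = 1.  There the form
   sum_i (-1)^(i-1) x_i dx_1 .. ^dx_i .. dx_m giving the orientation restricts to
   dx_2 .. dx_m, so (x_2, .., x_m) are positively oriented coordinates.
   For m = 0 the projective space is empty.                                  *)
Definition simplex_integral m : dform R m -> R :=
  match m with
  | 0%N => fun=> 0
  | n.+1 => fun eta =>
      \int[lebesgue_tuple R n]_(y in @orthant n)
         pullback (@affine_chart n) eta (\row_i tnth y i) [set: 'I_n]%SET
  end.

End Simplex.

Section MatrixForms.
Variables (R : realType) (l : nat).

(* A point X is given by its vector of entries mxvec X, and a symmetric matrix
   is parametrised by its entries x_ij with i <= j.  Only the corresponding
   generators of ext R (l * l) occur below.                                  *)
Definition dX : 'M[ext R (l * l)]_l :=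
  \matrix_(i, j) dgen R (if i <= j then mxvec_index i j else mxvec_index j i)%N.

Definition inv_at (v : 'rV[R]_(l * l)) : 'M[ext R (l * l)]_l :=
  map_mx (fun r : R => r%:A) (invmx (vec_mx v)).

Definition beta_form (k : nat) : dform R (l * l) :=
  fun v => \tr ((inv_at v *m dX) ^+ (4 * k + 1)%N).

(* Pf A = 1 / (2^n n!) sum_s sgn(s) prod_(i < n) A_(s(2i), s(2i+1)) for
   l = 2n, for a skew-symmetric A with commuting entries; with l even,
   ordS i = i + 1 at even i (indices start at 0).                            *)
Definition pfaffian (B : lalgType R) (A : 'M[B]_l) : B :=
  if odd l then 0 else
  ((2 ^ l./2 * l./2`!)%N%:R)^-1 *:
    \sum_(s : 'S_l) (-1) ^+ s * \prod_(i < l | ~~ odd i) A (s i) (s (ordS i)).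

Definition phi_form : dform R (l * l) :=
  fun v => (Num.sqrt (\det (vec_mx v)))^-1 *: pfaffian (dX *m inv_at v *m dX).

End MatrixForms.

Local Open Scope fset_scope.

(* The monomial basis of Omega_can: S = {k_1 < ... < k_r} stands for
   beta^(4 k_1 + 5) /\ ... /\ beta^(4 k_r + 5), so that element k of S is the
   generator beta^(4 (k + 1) + 1).                                           *)
Definition degmon (S : {fset nat}) : nat := (\sum_(k <- S) (4 * k.+1 + 1))%N.

Record canform (d : nat) := Canform {
  coefs :> {fsfun {fset nat} -> rat with 0};
  canform_deg : forall S, S \in finsupp coefs -> degmon S = d }.

Definition can_at (R : realType) (l d : nat) (w : canform d) :
    dform R (l * l) :=
  fun v => \sum_(S <- finsupp w) (ratr (w S) : R) *:
             \prod_(k <- sort leq S) @beta_form R l k.+1 v.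

Record graph := Graph {
  vert : finType;
  edge : finType;
  halfedge : finType;
  edge_of : halfedge -> edge;
  end_of : halfedge -> vert;
  edge_ofP : forall e, #|[set h | edge_of h == e]%SET| = 2 }.

Section GraphDefs.
Variable G : graph.

Definition valency (v : vert G) : nat := #|[set h | end_of h == v]%SET|.

Definition adjacent (v w : vert G) : bool :=
  [exists h, exists h', [&& edge_of h == edge_of h' :> edge G,
     end_of h == v & end_of h' == w]].

Definition is_connected : Prop :=
  (0 < #|vert G|)%N /\ forall v w, connect adjacent v w.

(* no truncation occurs for connected graphs *)
Definition loops : nat := (#|edge G| + 1 - #|vert G|)%N.

Definition in_GC3 : Prop := is_connected /\ forall v, (3 <= valency v)%N.

(* Z^E with the edges listed by lab, each directed away from the half-edge
   tail e; this directs the coordinates of H_1(G) in Z^m.                    *)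
Definition is_cycle (lab : 'I_#|edge G| -> edge G) (tail : edge G -> halfedge G)
    (z : 'cV[int]_#|edge G|) : Prop :=
  forall v : vert G, \sum_(i < #|edge G|)
    \sum_(h | (edge_of h == lab i) && (end_of h == v))
      (if h == tail (lab i) then - z i 0 else z i 0) = 0.

(* A representative e_1 /\ ... /\ e_m (x) C_1 /\ ... /\ C_l of an orientation;
   the C_j are the columns of the matrix basis.                              *)
Record orientation := Orientation {
  lab : 'I_#|edge G| -> edge G;
  lab_bij : bijective lab;
  tail : edge G -> halfedge G;
  tailP : forall e, edge_of (tail e) = e;
  basis : 'M[int]_(#|edge G|, loops);
  basis_cycle : forall j, is_cycle lab tail (col j basis);
  basisP : forall z, is_cycle lab tail z ->
             exists! y : 'cV[int]_loops, z = basis *m y }.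

Variable R : realType.

Definition Lambda (o : orientation) (x : 'rV[R]_#|edge G|) : 'M[R]_loops :=
  let C : 'M[R]_(#|edge G|, loops) := map_mx (fun n : int => n%:~R) (basis o) in
  C^T *m diag_mx x *m C.

Definition pull_Lambda (o : orientation) (eta : dform R (loops * loops)) :
    dform R #|edge G| :=
  pullback (fun x => mxvec (Lambda o x)) eta.

(* By convention the integral is 0 unless loops + d = m - 1.
   For loops odd the form phi vanishes, so the value of the prefactor
   (-2 pi)^(- loops / 2) is irrelevant.                                      *)
Definition I_G (o : orientation) (d : nat) (w : canform d) : R :=
  if (loops + d).+1 == #|edge G| then
    ((- (2 * pi)) ^+ (loops./2))^-1 *
    simplex_integral (fun x : 'rV[R]_#|edge G| =>
       pull_Lambda o (@phi_form R loops) x * pull_Lambda o (@can_at R loops d w) x)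
  else 0.

End GraphDefs.

Arguments I_G {G} R o {d} w.

(* Main.v *)
(** Half-edge counting gives [2 m >= 3 V], hence [m <= 3 l - 3], while the
    degree condition is [m - 1 = l + d]; together they force [d <= 2 l - 4].  For
    even [l] this contradicts [l < 2 + 2 * ceil (d / 4)], so the integral is zero by
    convention; for odd [l] the Pfaffian form vanishes. *)
Require Import Defs.
From mathcomp Require Import all_boot all_order all_algebra all_reals.
From mathcomp Require Import all_classical all_analysis.
From mathcomp Require Import zify.
Import Order.TTheory GRing.Theory Num.Theory.
Local Open Scope ring_scope.

Lemma sum_card_fibers (I J : finType) (f : I -> J) :
  (\sum_(j : J) #|[set i | f i == j]%SET| = #|I|)%N.
Proof.
rewrite -sum1_card (partition_big f predT) //=; apply: eq_bigr => j _.
by rewrite -sum1_card; apply: eq_bigl => i; rewrite inE.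
Qed.

Lemma card_halfedge (G : graph) : #|halfedge G| = (2 * #|edge G|)%N.
Proof.
rewrite -(sum_card_fibers _ _ (@edge_of G)) (eq_bigr (fun=> 2%N)).
  by rewrite sum_nat_const mulnC.
by move=> e _; rewrite edge_ofP.
Qed.

Lemma leq_card_vert_edge (G : graph) :
  (forall v : vert G, 3 <= valency v)%N -> (3 * #|vert G| <= 2 * #|edge G|)%N.
Proof.
move=> val3; rewrite -card_halfedge -(sum_card_fibers _ _ (@end_of G)).
by rewrite mulnC -sum_nat_const; apply: leq_sum => v _; exact: val3.
Qed.

(** Substitute [V = E + 1 - loops] into [3 V <= 2 E]; that bound also rules out truncation in
    [loops]. *)
Lemma leq_card_edge_loops (G : graph) :
  in_GC3 G -> (#|edge G| + 3 <= 3 * loops G)%N.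
Proof.
move=> [[V0 _] /leq_card_vert_edge]; rewrite /loops.
by move: V0; move: #|vert G| #|edge G| => a b; lia.
Qed.

Lemma pullback0 (R : realType) (n p : nat) (F : 'rV[R]_n -> 'rV[R]_p)
    (eta : dform R p) (x : 'rV[R]_n) :
  eta (F x) = 0 -> pullback F eta x = 0.
Proof.
by move=> eta0; rewrite /pullback big1 // => S _; rewrite eta0 ffunE scale0r.
Qed.

Lemma phi_form_odd (R : realType) (l : nat) (v : 'rV[R]_(l * l)) :
  odd l -> phi_form v = 0.
Proof. by move=> lodd; rewrite /phi_form /pfaffian lodd scaler0. Qed.

Lemma simplex_integral0 (R : realType) (m : nat) (eta : dform R m) :
  (forall x, eta x = 0) -> simplex_integral eta = 0.
Proof.
(* For [m = 0] the integral is 0 by definition. *)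
case: m eta => [//|n] eta eta0 /=; rewrite /Rintegral integral0_eq // => y _.
by rewrite pullback0 ?ffunE.
Qed.

Theorem lemma1p5 (R : realType) (d : nat) (w : canform d) (l : nat)
    (hl : l%:Z < 2 + 2 * Num.ceil (d%:R / 4 : rat))
    (G : graph) (hG : in_GC3 G) (hGl : loops G = l) (o : orientation G) :
  I_G R o w = 0.
Proof.
rewrite /I_G; case: eqP => // degE.
case: (boolP (odd (loops G))) => [lodd|leven].
  rewrite simplex_integral0 ?mulr0 // => x.
  by rewrite /pull_Lambda pullback0 ?mul0r // phi_form_odd.
have mE := leq_card_edge_loops G hG; rewrite -degE hGl in mE.
have lE : l = (2 * l./2)%N by rewrite hGl in leven; lia.
(* [mE] reads [d + 4 <= 2 l], so [l] is positive, hence at least 2 by parity, and [l./2 - 1] is not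
   truncated. *)
have dle : (d <= 4 * (l./2 - 1))%N by lia.
(* The bound on [d / 4] is an integer, so it passes to the ceiling; doubling gives
   [2 + 2 * ceil (d / 4) <= l], against [hl]. *)
have : Num.ceil (d%:R / 4 : rat) <= (l./2 - 1)%N%:Z.
  rewrite ceil_le_int ler_pdivrMr // -[_%:~R]/(_%:R) -natrM ler_nat.
  by rewrite mulnC.
by move: hl; lia.
Qed.
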